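(* Fix an LE-signature $(\mathcal{F},\mathcal{G})$. Every rule of the refutation display calculus $\mathrm{D.LE}^r$ (described in the context) is sound with respect to the class of complete $\mathcal{L}$-algebras of the corresponding signature. That is, for every instance of a rule of $\mathrm{D.LE}^r$ with premises $\Pi_1\nvdash\Sigma_1,\ldots,\Pi_k\nvdash\Sigma_k$ ($k\ge 0$) and conclusion $\Pi\nvdash\Sigma$: if none of the sequents $\Pi_1\vdash\Sigma_1,\ldots,\Pi_k\vdash\Sigma_k$ is valid on all complete $\mathcal{L}$-algebras, then $\Pi\vdash\Sigma$ is not valid on all complete $\mathcal{L}$-algebras. For zero-premise rules this means $\Pi\vdash\Sigma$ is not valid on all complete $\mathcal{L}$-algebras.
   Context: Order-types. An order-type on $n$ is $\epsilon\in\{1,\partial\}^n$. The product on $\{1,\partial\}$ behaves like multiplication on $\{1,-1\}$ (so $1\cdot 1=\partial\cdot\partial=1$). We write $\epsilon^\partial$ for the opposite order-type. Notation: $\varphi\vdash^1\psi$ and $\varphi\nvdash^1\psi$ are $\varphi\vdash\psi$ and $\varphi\nvdash\psi$; $\varphi\vdash^\partial\psi$ means $\psi\vdash\varphi$ and $\varphi\nvdash^\partial\psi$ means $\psi\nvdash\varphi$. Also $\check\bot^1=\check\bot$, $\check\bot^\partial=\hat\top$, $\hat\top^1=\hat\top$, $\hat\top^\partial=\check\bot$. Language. $\mathsf{AtProp}$ is a denumerable set of atoms $p,q,\ldots$. $\mathcal{F},\mathcal{G}$ are disjoint sets of connectives. Each $f\in\mathcal{F}$ has an arity $n_f$ and order-type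 $\epsilon_f$ on $n_f$. Likewise each $g\in\mathcal{G}$ has arity $n_g$ and order-type $\epsilon_g$. Formulas: $\varphi::=p\mid\bot\mid\top\mid\varphi\wedge\varphi\mid\varphi\vee\varphi\mid f(\varphi_1,\ldots,\varphi_{n_f})\mid g(\varphi_1,\ldots,\varphi_{n_g})$. Residuated expansion. $\mathcal{F}^*\supseteq\mathcal{F}$ and $\mathcal{G}^*\supseteq\mathcal{G}$ add, for every $f\in\mathcal{F}$ and $1\le i\le n_f$, an $n_f$-ary $f^\sharp_i$, and for every $g\in\mathcal{G}$ and $1\le i\le n_g$, an $n_g$-ary $g^\flat_i$. Here $f^\sharp_i\in\mathcal{G}^*$ if $\epsilon_f(i)=1$ and $f^\sharp_i\in\mathcal{F}^*$ if $\epsilon_f(i)=\partial$. Also $g^\flat_i\in\mathcal{F}^*$ if $\epsilon_g(i)=1$ and $g^\flat_i\in\mathcal{G}^*$ if $\epsilon_g(i)=\partial$. The order-types are $\epsilon_{f^\sharp_i}(i)=\epsilon_f(i)$ and $\epsilon_{f^\sharp_i}(j)=\epsilon_f(j)\cdot\epsilon_f^\partial(i)$ for $j\ne i$, and similarly for $g^\flat_i$. $f^\sharp_i$ is interpreted as the right residual of $f$ in coordinate $i$ if $\epsilon_f(i)=1$, and as its Galois adjoint otherwise. $g^\flat_i$ is interpreted as the left residual of $g$ in coordinate $i$ if $\epsilon_g(i)=1$, and as its Galois adjoint otherwise. Structures. Structural connectives are $\hat h$ for $h\in\mathcal{F}^*$ and $\check h$ for $h\in\mathcal{G}^*$, with the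 same arity and order-type as $h$. Precedent structures are $\Pi::=\varphi\mid\hat\top\mid\hat f(\Upsilon_1,\ldots,\Upsilon_n)$ ($f\in\mathcal{F}^*$). Succedent structures are $\Sigma::=\varphi\mid\check\bot\mid\check g(\Upsilon_1,\ldots,\Upsilon_n)$ ($g\in\mathcal{G}^*$). In these clauses $\varphi$ is a formula. The $i$-th argument of $\hat f$ (resp. $\check g$) is precedent if the order-type of that coordinate is $1$ (resp. $\partial$) and succedent otherwise. Sequents are $\Pi\vdash\Sigma$ and antisequents are $\Pi\nvdash\Sigma$ (with $\Pi$ precedent, $\Sigma$ succedent). An (anti)sequent or structure contains residuals if it contains a structural connective $\hat h$ or $\check h$ with $h$ one of the added connectives $f^\sharp_i,g^\flat_i$. Display rules (invertible, for sequents and antisequents alike; $\bowtie$ stands for $\vdash$ or $\nvdash$), for $f\in\mathcal{F}$, $g\in\mathcal{G}$: - If $\epsilon_f(i)=1$: $\hat f(\Upsilon_1,..,\Pi_i,..,\Upsilon_n)\bowtie\Sigma$ iff $\Pi_i\bowtie\check f^\sharp_i(\Upsilon_1,..,\Sigma,..,\Upsilon_n)$. - If $\epsilon_f(i)=\partial$: $\hat f(\Upsilon_1,..,\Sigma_i,..,\Upsilon_n)\bowtie\Sigma$ iff $\hat f^\sharp_i(\Upsilon_1,..,\Sigma,..,\Upsilon_n)\bowtie\Sigma_i$. - If $\epsilon_g(j)=1$: $\Pi\bowtie\check g(\Upsilon_1,..,\Sigma_j,..,\Upsilon_n)$ iff $\hat g^\flat_j(\Upsilon_1,..,\Pi,..,\Upsilon_n)\bowtie\Sigma_j$.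 - If $\epsilon_g(j)=\partial$: $\Pi\bowtie\check g(\Upsilon_1,..,\Pi_j,..,\Upsilon_n)$ iff $\Pi_j\bowtie\check g^\flat_j(\Upsilon_1,..,\Pi,..,\Upsilon_n)$. Two (anti)sequents are display-equivalent if interderivable by finitely many display rules. An occurrence of a substructure $\Upsilon'$ in an (anti)sequent $S$ is in precedent (resp. succedent) position if $S$ is display-equivalent to one in which that occurrence is the whole left (resp. right) side. $S[\Upsilon''/\Upsilon']$ denotes replacement of that occurrence. For a structure $\Sigma'$ containing occurrences of $A_i\wedge B_i$ in precedent position and $C_j\vee D_j$ in succedent position, $\Sigma'[A_i]^{pre}$ denotes $\Sigma'$ with that occurrence of $A_i\wedge B_i$ replaced by $A_i$, and similarly for $B_i$, $C_j$, $D_j$. Branching. In $\Pi\vdash\Sigma$, the signed generation trees of $\Pi$ and $\Sigma$ are formed as follows. Assign $+$ to the root of $\Pi$ and $-$ to the root of $\Sigma$. Propagate through structural and operational connectives (with $\wedge,\vee$ of order-type $(1,1)$): a child in a coordinate of order-type $1$ gets the parent's sign, and one of order-type $\partial$ gets the opposite sign. A precedent (resp. succedent) structure is branching if its tree, rooted with $+$ (resp. $-$), contains a node $+\vee$ or $-\wedge$ such that all nodes strictly between it and the root are labelled in $\{+f,+\hat f,-g,-\check g\mid f\in\mathcal{F},g\in\mathcal{G}\}$. Rules of $\mathrm{D.LE}^r$ ($f,f_1,f_2\in\mathcal{F}$, $g,g_1,g_2\in\mathcal{G}$, $n=n_f$ or $n_g$ as appropriate): - Axioms: $\hat\top\nvdash\check\bot$;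 $p\nvdash\check\bot$; $\hat\top\nvdash q$; $p\nvdash q$ (with $p,q$ distinct atoms). - The display rules above (with $\nvdash$). - Structural rules, whose conclusion must contain no residuals: - $\hat f\check\bot$: from $\Upsilon_i\nvdash^{\epsilon_f(i)}\check\bot^{\epsilon_f(i)}$ for all $1\le i\le n_f$, infer $\hat f(\Upsilon_1,..,\Upsilon_n)\nvdash\check\bot$. - $\hat f p$: from the same premises, infer $\hat f(\overline\Upsilon)\nvdash p$. - $\hat\top\check g$: from $\hat\top^{\epsilon_g(i)}\nvdash^{\epsilon_g(i)}\Upsilon_i$ for all $i$, infer $\hat\top\nvdash\check g(\overline\Upsilon)$. - $p\check g$: from the same premises, infer $p\nvdash\check g(\overline\Upsilon)$. - $\hat f\check g$: from $\Upsilon_i\nvdash^{\epsilon_f(i)}\check\bot^{\epsilon_f(i)}$ for all $i\le n_f$ and $\hat\top^{\epsilon_g(i)}\nvdash^{\epsilon_g(i)}\Upsilon'_i$ for all $i\le n_g$, infer $\hat f(\overline\Upsilon)\nvdash\check g(\overline{\Upsilon'})$. - Logical rules: - Zero-premise: $g(\overline\varphi)\nvdash\check\bot$; $g(\overline\varphi)\nvdash p$; $p\nvdash f(\overline\varphi)$; $\hat\top\nvdash f(\overline\varphi)$; $g(\overline\psi)\nvdash f(\overline\varphi)$. - $f_L$: from $\hat f(\overline\varphi)\nvdash\Sigma$ infer $f(\overline\varphi)\nvdash\Sigma$. - $g_R$: from $\Pi\nvdash\check g(\overline\varphi)$ infer $\Pi\nvdash g(\overline\varphi)$. - $f_R$: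 from $\Upsilon_i\nvdash^{\epsilon_f(i)}\check\bot^{\epsilon_f(i)}$ for all $i$ and $\Upsilon_j\nvdash^{\epsilon_f(j)}\varphi_j$ for some $j$, infer $\hat f(\Upsilon_1,..,\Upsilon_n)\nvdash f(\varphi_1,..,\varphi_n)$. - $g_L$: from $\hat\top^{\epsilon_g(i)}\nvdash^{\epsilon_g(i)}\Upsilon_i$ for all $i$ and $\varphi_j\nvdash^{\epsilon_g(j)}\Upsilon_j$ for some $j$, infer $g(\overline\varphi)\nvdash\check g(\overline\Upsilon)$. - $g^{\neq}_L$ (for $g_1\ne g_2$): from $\hat\top^{\epsilon_{g_2}(i)}\nvdash^{\epsilon_{g_2}(i)}\Upsilon_i$ for all $i\le n_{g_2}$, infer $g_1(\overline\varphi)\nvdash\check g_2(\overline\Upsilon)$. - $f^{\neq}_R$ (for $f_1\ne f_2$): from $\Upsilon_i\nvdash^{\epsilon_{f_1}(i)}\check\bot^{\epsilon_{f_1}(i)}$ for all $i\le n_{f_1}$, infer $\hat f_1(\overline\Upsilon)\nvdash f_2(\overline\varphi)$. - The conclusions of $f_R,f^{\neq}_R,g_L,g^{\neq}_L$ must contain no residuals. - Lattice rules: - $\top_L$: from $\hat\top\nvdash\Sigma$ infer $\top\nvdash\Sigma$. - $\vee_{L_i}$ ($i=1,2$): from $\varphi_i\nvdash\Sigma$ infer $\varphi_1\vee\varphi_2\nvdash\Sigma$. - $\wedge_{R_i}$: from $\Pi\nvdash\varphi_i$ infer $\Pi\nvdash\varphi_1\wedge\varphi_2$. - $\bot_R$: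 from $\Pi\nvdash\check\bot$ infer $\Pi\nvdash\bot$. - $\wedge_L$: let $\Sigma'$ contain families of occurrences $(A_i\wedge B_i)_{i\in I}$ in precedent position and $(C_j\vee D_j)_{j\in J}$ in succedent position. From $\varphi\nvdash\Sigma'$, $\psi\nvdash\Sigma'$, and $\varphi\wedge\psi\nvdash\Sigma'[A_i]^{pre}$, $\varphi\wedge\psi\nvdash\Sigma'[B_i]^{pre}$ ($i\in I$), $\varphi\wedge\psi\nvdash\Sigma'[C_j]^{suc}$, $\varphi\wedge\psi\nvdash\Sigma'[D_j]^{suc}$ ($j\in J$), infer $\varphi\wedge\psi\nvdash\Sigma'$. - $\vee_R$: dually, from $\Pi'\nvdash\varphi$, $\Pi'\nvdash\psi$ and $\Pi'[A_i]^{pre}\nvdash\varphi\vee\psi$, $\Pi'[B_i]^{pre}\nvdash\varphi\vee\psi$, $\Pi'[C_j]^{suc}\nvdash\varphi\vee\psi$, $\Pi'[D_j]^{suc}\nvdash\varphi\vee\psi$, infer $\Pi'\nvdash\varphi\vee\psi$. - In $\wedge_L$ and $\vee_R$, $\Sigma'$ (resp. $\Pi'$) must not be branching and the conclusion must contain no residuals. Semantics. A complete $\mathcal{L}$-algebra is a complete lattice with an $n_f$-ary operation for each $f\in\mathcal{F}$ and an $n_g$-ary operation for each $g\in\mathcal{G}$. Each $f$ is completely join-preserving in coordinates $i$ with $\epsilon_f(i)=1$ and completely meet-reversing (sending meets to joins) where $\epsilon_f(i)=\partial$. Dually, each $g$ is completely meet-preserving in coordinates with $\epsilon_g(i)=1$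 and completely join-reversing where $\epsilon_g(i)=\partial$. Such algebras interpret all $f^\sharp_i,g^\flat_i$ as the corresponding residuals/adjoints. Under an assignment of atoms, formulas are interpreted as usual, $\hat\top$ as top, $\check\bot$ as bottom, and $\hat h$, $\check h$ as the operation interpreting $h$. A sequent $\Pi\vdash\Sigma$ is valid on a class of algebras if the value of $\Pi$ is $\le$ the value of $\Sigma$ under every assignment in every algebra of the class.
   Formalization: In ∧_L and ∨_R the families are taken to be all occurrences of A∧B in precedent and C∨D in succedent position, including those inside formulas below only +f and −g; otherwise the rule fails, e.g. f((p∨q)∧r) ⊢ f(p)∨f(q) is valid although neither disjunct's sequent is. *)

(* Defs.v *)
From Stdlib Require List.
From mathcomp Require Import all_boot.

Set Implicit Arguments.
Unset Strict Implicit.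
Unset Printing Implicit Defensive.

Inductive otype : Type := one | del (* the dual order-type *).

Definition oopp (e : otype) : otype := if e is one then del else one.

Definition omul (e e' : otype) : otype := if e is one then e' else oopp e'.

(* [Pre] is the sign + (precedent position), [Suc] the sign - (succedent
   position). *)
Inductive position : Type := Pre | Suc.

Definition act (p : position) (e : otype) : position :=
  match e, p with
  | one, _ => p
  | del, Pre => Suc
  | del, Suc => Pre
  end.

Record le_signature : Type := LeSignature {
  Fconn : Type;
  Gconn : Type;
  arF : Fconn -> nat;
  arG : Gconn -> nat;
  epsF : forall f : Fconn, 'I_(arF f) -> otype;
  epsG : forall g : Gconn, 'I_(arG g) -> otype
}.

Arguments epsF {_} f i.
Arguments epsG {_} g i.

Definition upd (n : nat) (T : Type) (a : 'I_n -> T) (i : 'I_n) (x : T) :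
  'I_n -> T := fun j => if j == i then x else a j.

Inductive formula (S : le_signature) : Type :=
  | Atom of nat
  | Bot
  | Top
  | And of formula S & formula S
  | Or of formula S & formula S
  | FApp (f : Fconn S) of 'I_(arF f) -> formula S
  | GApp (g : Gconn S) of 'I_(arG g) -> formula S.

Arguments Atom {S} _.
Arguments Bot {S}.
Arguments Top {S}.
Arguments And {S} _ _.
Arguments Or {S} _ _.
Arguments FApp {S} f _.
Arguments GApp {S} g _.

(* The connectives of the expanded language: the disjoint union of F* and G*,
   told apart by [conn_pos]. *)
Inductive conn (S : le_signature) : Type :=
  | CF of Fconn S
  | CG of Gconn S
  | CSharp (f : Fconn S) of 'I_(arF f)
  | CFlat (g : Gconn S) of 'I_(arG g).

Arguments CF {S} f.
Arguments CG {S} g.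
Arguments CSharp {S} f i.
Arguments CFlat {S} g i.

Definition conn_ar (S : le_signature) (c : conn S) : nat :=
  match c with
  | CF f => arF f
  | CG g => arG g
  | CSharp f _ => arF f
  | CFlat g _ => arG g
  end.

Definition conn_eps (S : le_signature) (c : conn S) : 'I_(conn_ar c) -> otype :=
  match c return 'I_(conn_ar c) -> otype with
  | CF f => epsF f
  | CG g => epsG g
  | CSharp f i => fun j =>
      if j == i then epsF f i else omul (epsF f j) (oopp (epsF f i))
  | CFlat g i => fun j =>
      if j == i then epsG g i else omul (epsG g j) (oopp (epsG g i))
  end.

(* [conn_pos c = Pre] iff c is in F*, and [conn_pos c = Suc] iff c is in G*. *)
Definition conn_pos (S : le_signature) (c : conn S) : position :=
  match c with
  | CF _ => Pre
  | CG _ => Suc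
  | CSharp f i => if epsF f i is one then Suc else Pre
  | CFlat g i => if epsG g i is one then Pre else Suc
  end.

(* Raw structures; [SApp c] is the hatted connective when c is in F* and the
   checked one when c is in G*.  The grammar of precedent and succedent
   structures is imposed by [wf]. *)
Inductive structure (S : le_signature) : Type :=
  | SForm of formula S
  | STop
  | SBot
  | SApp (c : conn S) of 'I_(conn_ar c) -> structure S.

Arguments SForm {S} _.
Arguments STop {S}.
Arguments SBot {S}.
Arguments SApp {S} c _.

Fixpoint wf (S : le_signature) (p : position) (s : structure S) : Prop :=
  match s with
  | SForm _ => True
  | STop => p = Pre
  | SBot => p = Suc
  | SApp c a => conn_pos c = p /\ forall i, wf (act p (conn_eps i)) (a i)
  end.

(* The pair (Pi, Sigma) stands both for the sequent and for the antisequent. *)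
Definition sequent (S : le_signature) : Type := (structure S * structure S)%type.

Definition wf_seq (S : le_signature) (q : sequent S) : Prop :=
  wf Pre q.1 /\ wf Suc q.2.

Fixpoint residual_free (S : le_signature) (s : structure S) : Prop :=
  match s with
  | SApp c a =>
      match c with CF _ | CG _ => True | CSharp _ _ | CFlat _ _ => False end
      /\ forall i, residual_free (a i)
  | _ => True
  end.

Definition residual_free_seq (S : le_signature) (q : sequent S) : Prop :=
  residual_free q.1 /\ residual_free q.2.

(* A node of a signed generation tree, given by its sign and the subtree
   below it; a formula node is wrapped in [SForm]. *)
Definition snode (S : le_signature) : Type := (position * structure S)%type.

Inductive child (S : le_signature) : snode S -> snode S -> Prop :=
  | child_andl p A B : child (p, SForm (And A B)) (p, SForm A)
  | child_andr p A B : child (p, SForm (And A B)) (p, SForm B)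
  | child_orl p A B : child (p, SForm (Or A B)) (p, SForm A)
  | child_orr p A B : child (p, SForm (Or A B)) (p, SForm B)
  | child_f p f a i :
      child (p, SForm (FApp f a)) (act p (epsF f i), SForm (a i))
  | child_g p g a i :
      child (p, SForm (GApp g a)) (act p (epsG g i), SForm (a i))
  | child_s p c a i : child (p, SApp c a) (act p (conn_eps i), a i).

(* The labels +f, +f^, -g, -g^ with f in F and g in G. *)
Definition skeleton (S : le_signature) (n : snode S) : Prop :=
  match n with
  | (Pre, SForm (FApp _ _)) | (Pre, SApp (CF _) _)
  | (Suc, SForm (GApp _ _)) | (Suc, SApp (CG _) _) => True
  | _ => False
  end.

Definition critical (S : le_signature) (n : snode S) : Prop :=
  match n with
  | (Pre, SForm (Or _ _)) | (Suc, SForm (And _ _)) => True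
  | _ => False
  end.

Inductive reaches_critical (S : le_signature) : snode S -> Prop :=
  | reaches_here n : critical n -> reaches_critical n
  | reaches_below n m :
      skeleton n -> child n m -> reaches_critical m -> reaches_critical n.

(* The label of the root itself is unconstrained. *)
Definition branching (S : le_signature) (p : position) (s : structure S) : Prop :=
  critical (p, s) \/ exists2 n, child (p, s) n & reaches_critical n.

(* [sreducts p s] lists the structures s[A_i], s[B_i], s[C_j], s[D_j], where
   the families range over all occurrences of A_i /\ B_i in precedent position
   and of C_j \/ D_j in succedent position in s, s itself being in position p.
   An occurrence may lie inside a formula at the leaves of s provided every
   formula connective above it is a +f or a -g, i.e. provided it becomes a
   displayable substructure once these are turned into structural connectives.
   These occurrences cannot be left out: for unary f of order-type 1, the
   sequent f((p \/ q) /\ r) |- f(p) \/ f(q) is valid, its left side is not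
   branching, and f((p \/ q) /\ r) |- f(p), f((p \/ q) /\ r) |- f(q) are both
   not valid. *)
Fixpoint freducts (S : le_signature) (p : position) (A : formula S) :
    seq (formula S) :=
  match A with
  | And B C => if p is Pre then [:: B; C] else [::]
  | Or B C => if p is Suc then [:: B; C] else [::]
  | FApp f a =>
      if p is Pre then
        flatten [seq [seq FApp f (upd a i B) | B <- freducts (act p (epsF f i)) (a i)]
                | i <- enum 'I_(arF f)]
      else [::]
  | GApp g a =>
      if p is Suc then
        flatten [seq [seq GApp g (upd a i B) | B <- freducts (act p (epsG g i)) (a i)]
                | i <- enum 'I_(arG g)]
      else [::]
  | _ => [::]
  end.

Fixpoint sreducts (S : le_signature) (p : position) (s : structure S) :
    seq (structure S) :=
  match s with
  | SForm A => [seq SForm B | B <- freducts p A]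
  | SApp c a =>
      flatten [seq [seq SApp c (upd a i t) | t <- sreducts (act p (conn_eps i)) (a i)]
              | i <- enum 'I_(conn_ar c)]
  | _ => [::]
  end.

(* [orient e X Y] is X |-^e Y (or its negation). *)
Definition orient (S : le_signature) (e : otype) (X Y : structure S) : sequent S :=
  if e is one then (X, Y) else (Y, X).

Definition sbot (S : le_signature) (e : otype) : structure S :=
  if e is one then SBot else STop.

Definition stop (S : le_signature) (e : otype) : structure S :=
  if e is one then STop else SBot.

Definition nonbot_premises (S : le_signature) (f : Fconn S)
    (X : 'I_(arF f) -> structure S) : seq (sequent S) :=
  [seq orient (epsF f i) (X i) (sbot S (epsF f i)) | i <- enum 'I_(arF f)].

Definition nontop_premises (S : le_signature) (g : Gconn S)
    (X : 'I_(arG g) -> structure S) : seq (sequent S) :=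
  [seq orient (epsG g i) (stop S (epsG g i)) (X i) | i <- enum 'I_(arG g)].

Definition sforms (S : le_signature) (n : nat) (A : 'I_n -> formula S) :
  'I_n -> structure S := fun i => SForm (A i).

Definition SF (S : le_signature) (f : Fconn S) (X : 'I_(arF f) -> structure S) :
  structure S := SApp (CF f) X.

Definition SG (S : le_signature) (g : Gconn S) (X : 'I_(arG g) -> structure S) :
  structure S := SApp (CG g) X.

Definition SSharp (S : le_signature) (f : Fconn S) (i : 'I_(arF f))
  (X : 'I_(arF f) -> structure S) : structure S := SApp (CSharp f i) X.

Definition SFlat (S : le_signature) (g : Gconn S) (i : 'I_(arG g))
  (X : 'I_(arG g) -> structure S) : structure S := SApp (CFlat g i) X.

Inductive display (S : le_signature) : sequent S -> sequent S -> Prop :=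
  | display_f1 f i X Y : epsF f i = one ->
      display (SF (f := f) X, Y) (X i, SSharp i (upd X i Y))
  | display_fd f i X Y : epsF f i = del ->
      display (SF (f := f) X, Y) (SSharp i (upd X i Y), X i)
  | display_g1 g i X Y : epsG g i = one ->
      display (Y, SG (g := g) X) (SFlat i (upd X i Y), X i)
  | display_gd g i X Y : epsG g i = del ->
      display (Y, SG (g := g) X) (X i, SFlat i (upd X i Y)).

(* [rule ps q]: the antisequent q follows from the antisequents ps by one rule;
   side conditions on residuals bear on the conclusion only. *)
Inductive rule (S : le_signature) : seq (sequent S) -> sequent S -> Prop :=
  | ax_top_bot : rule [::] (STop, SBot)
  | ax_p_bot p : rule [::] (SForm (Atom p), SBot)
  | ax_top_q q : rule [::] (STop, SForm (Atom q))
  | ax_p_q p q : p <> q -> rule [::] (SForm (Atom p), SForm (Atom q))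
  | r_display q q' : display q q' -> rule [:: q] q'
  | r_display_inv q q' : display q q' -> rule [:: q'] q
  | r_f_bot f X :
      residual_free_seq (SF (f := f) X, SBot) ->
      rule (nonbot_premises X) (SF X, SBot)
  | r_f_p f X p :
      residual_free_seq (SF (f := f) X, SForm (Atom p)) ->
      rule (nonbot_premises X) (SF X, SForm (Atom p))
  | r_top_g g Y :
      residual_free_seq (STop, SG (g := g) Y) ->
      rule (nontop_premises Y) (STop, SG Y)
  | r_p_g p g Y :
      residual_free_seq (SForm (Atom p), SG (g := g) Y) ->
      rule (nontop_premises Y) (SForm (Atom p), SG Y)
  | r_f_g f X g Y :
      residual_free_seq (SF (f := f) X, SG (g := g) Y) ->
      rule (nonbot_premises X ++ nontop_premises Y) (SF X, SG Y)
  | r_gbot g A : rule [::] (SForm (GApp g A), SBot)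
  | r_gp g A p : rule [::] (SForm (GApp g A), SForm (Atom p))
  | r_pf p f A : rule [::] (SForm (Atom p), SForm (FApp f A))
  | r_topf f A : rule [::] (STop, SForm (FApp f A))
  | r_gf g B f A : rule [::] (SForm (GApp g B), SForm (FApp f A))
  | r_fL f A Y : rule [:: (SF (f := f) (sforms A), Y)] (SForm (FApp f A), Y)
  | r_gR g A X : rule [:: (X, SG (g := g) (sforms A))] (X, SForm (GApp g A))
  | r_fR f X A j :
      residual_free_seq (SF (f := f) X, SForm (FApp f A)) ->
      rule (rcons (nonbot_premises X) (orient (epsF f j) (X j) (SForm (A j))))
           (SF X, SForm (FApp f A))
  | r_gL g A Y j :
      residual_free_seq (SForm (GApp g A), SG (g := g) Y) ->
      rule (rcons (nontop_premises Y) (orient (epsG g j) (SForm (A j)) (Y j)))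
           (SForm (GApp g A), SG Y)
  | r_gL_neq g1 g2 A Y : g1 <> g2 ->
      residual_free_seq (SForm (GApp g1 A), SG (g := g2) Y) ->
      rule (nontop_premises Y) (SForm (GApp g1 A), SG Y)
  | r_fR_neq f1 f2 X A : f1 <> f2 ->
      residual_free_seq (SF (f := f1) X, SForm (FApp f2 A)) ->
      rule (nonbot_premises X) (SF X, SForm (FApp f2 A))
  | r_topL Y : rule [:: (STop, Y)] (SForm Top, Y)
  | r_orL1 A B Y : rule [:: (SForm A, Y)] (SForm (Or A B), Y)
  | r_orL2 A B Y : rule [:: (SForm B, Y)] (SForm (Or A B), Y)
  | r_andR1 X A B : rule [:: (X, SForm A)] (X, SForm (And A B))
  | r_andR2 X A B : rule [:: (X, SForm B)] (X, SForm (And A B))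
  | r_botR X : rule [:: (X, SBot)] (X, SForm Bot)
  | r_andL A B Y :
      ~ branching Suc Y ->
      residual_free_seq (SForm (And A B), Y) ->
      rule [:: (SForm A, Y), (SForm B, Y)
            & [seq (SForm (And A B), Y') | Y' <- sreducts Suc Y]]
           (SForm (And A B), Y)
  | r_orR X A B :
      ~ branching Pre X ->
      residual_free_seq (X, SForm (Or A B)) ->
      rule [:: (X, SForm A), (X, SForm B)
            & [seq (X', SForm (Or A B)) | X' <- sreducts Pre X]]
           (X, SForm (Or A B)).

(* All sequents involved must obey the grammar of structures. *)
Definition rule_instance (S : le_signature) (ps : seq (sequent S))
    (q : sequent S) : Prop :=
  [/\ rule ps q, forall r, List.In r ps -> wf_seq r & wf_seq q].

Record complete_lattice : Type := CompleteLattice {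
  carrier :> Type;
  lle : carrier -> carrier -> Prop;
  lle_refl : forall x, lle x x;
  lle_anti : forall x y, lle x y -> lle y x -> x = y;
  lle_trans : forall x y z, lle x y -> lle y z -> lle x z;
  lsup : (carrier -> Prop) -> carrier;
  lsupP : forall (D : carrier -> Prop) u,
    lle (lsup D) u <-> forall x, D x -> lle x u;
  linf : (carrier -> Prop) -> carrier;
  linfP : forall (D : carrier -> Prop) l,
    lle l (linf D) <-> forall x, D x -> lle l x
}.

Definition ltop (L : complete_lattice) : L := linf (fun _ : L => False).
Definition lbot (L : complete_lattice) : L := lsup (fun _ : L => False).
Definition lmeet2 (L : complete_lattice) (x y : L) : L :=
  linf (fun z => z = x \/ z = y).
Definition ljoin2 (L : complete_lattice) (x y : L) : L :=
  lsup (fun z => z = x \/ z = y).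

Definition img (T U : Type) (h : T -> U) (D : T -> Prop) : U -> Prop :=
  fun u => exists2 x, D x & u = h x.

Record le_algebra (S : le_signature) : Type := LeAlgebra {
  lat :> complete_lattice;
  fop : forall f : Fconn S, ('I_(arF f) -> lat) -> lat;
  gop : forall g : Gconn S, ('I_(arG g) -> lat) -> lat;
  fop_one : forall f i x (D : lat -> Prop), epsF f i = one ->
    fop (upd x i (lsup D)) = lsup (img (fun y => @fop f (upd x i y)) D);
  fop_del : forall f i x (D : lat -> Prop), epsF f i = del ->
    fop (upd x i (linf D)) = lsup (img (fun y => @fop f (upd x i y)) D);
  gop_one : forall g i x (D : lat -> Prop), epsG g i = one ->
    gop (upd x i (linf D)) = linf (img (fun y => @gop g (upd x i y)) D);
  gop_del : forall g i x (D : lat -> Prop), epsG g i = del ->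
    gop (upd x i (lsup D)) = linf (img (fun y => @gop g (upd x i y)) D)
}.

Arguments fop {S} _ f x : rename.
Arguments gop {S} _ g x : rename.

(* Residuals and Galois adjoints; see the adjunction lemmas below. *)
Definition sharp (S : le_signature) (L : le_algebra S) (f : Fconn S)
    (i : 'I_(arF f)) (x : 'I_(arF f) -> L) : L :=
  let D := fun y => lle (fop L f (upd x i y)) (x i) in
  if epsF f i is one then lsup D else linf D.

Definition flat (S : le_signature) (L : le_algebra S) (g : Gconn S)
    (i : 'I_(arG g)) (x : 'I_(arG g) -> L) : L :=
  let D := fun y => lle (x i) (gop L g (upd x i y)) in
  if epsG g i is one then linf D else lsup D.

Definition conn_op (S : le_signature) (L : le_algebra S) (c : conn S) :
    ('I_(conn_ar c) -> L) -> L :=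
  match c return ('I_(conn_ar c) -> L) -> L with
  | CF f => fop L f
  | CG g => gop L g
  | CSharp f i => fun x => sharp i x
  | CFlat g i => fun x => flat i x
  end.

Fixpoint forval (S : le_signature) (L : le_algebra S) (v : nat -> L)
    (A : formula S) : L :=
  match A with
  | Atom p => v p
  | Bot => lbot L
  | Top => ltop L
  | And B C => lmeet2 (forval v B) (forval v C)
  | Or B C => ljoin2 (forval v B) (forval v C)
  | FApp f a => fop L f (fun i => forval v (a i))
  | GApp g a => gop L g (fun i => forval v (a i))
  end.

Fixpoint strval (S : le_signature) (L : le_algebra S) (v : nat -> L)
    (s : structure S) : L :=
  match s with
  | SForm A => forval v A
  | STop => ltop L
  | SBot => lbot L
  | SApp c a => @conn_op S L c (fun i => strval v (a i))
  end.

Definition valid (S : le_signature) (q : sequent S) : Prop :=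
  forall (L : le_algebra S) (v : nat -> L), lle (strval v q.1) (strval v q.2).

Lemma lsup_ub (L : complete_lattice) (D : L -> Prop) (x : L) :
  D x -> lle x (lsup D).
Proof. by move=> Dx; apply: (proj1 (lsupP D _) (lle_refl _)). Qed.

Lemma linf_lb (L : complete_lattice) (D : L -> Prop) (x : L) :
  D x -> lle (linf D) x.
Proof. by move=> Dx; apply: (proj1 (linfP D _) (lle_refl _)). Qed.

Lemma lsup_max (L : complete_lattice) (y z : L) :
  lle y z -> lsup (fun w => w = y \/ w = z) = z.
Proof.
move=> yz; apply: lle_anti; last by apply: lsup_ub; right.
by apply/lsupP => x [->|->] //; apply: lle_refl.
Qed.

Lemma linf_min (L : complete_lattice) (y z : L) :
  lle z y -> linf (fun w => w = y \/ w = z) = z.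
Proof.
move=> yz; apply: lle_anti; first by apply: linf_lb; right.
by apply/linfP => x [->|->] //; apply: lle_refl.
Qed.

Section Adjunctions.
Context (S : le_signature) (L : le_algebra S).

Lemma sharp_one (f : Fconn S) i x (y : L) : epsF f i = one ->
  lle y (sharp i x) <-> lle (fop L f (upd x i y)) (x i).
Proof.
move=> e; rewrite /sharp e; split=> [yD|]; last by move=> h; apply: (@lsup_ub L).
apply: (@lle_trans _ _ (fop L f (upd x i (lsup (fun w : L =>
  lle (fop L f (upd x i w)) (x i)))))); last first.
  by rewrite fop_one //; apply/lsupP => _ [w Dw ->].
by rewrite -(lsup_max yD) fop_one //; apply: lsup_ub; exists y; first left.
Qed.

Lemma sharp_del (f : Fconn S) i x (y : L) : epsF f i = del ->
  lle (sharp i x) y <-> lle (fop L f (upd x i y)) (x i).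
Proof.
move=> e; rewrite /sharp e; split=> [yD|]; last by move=> h; apply: (@linf_lb L).
apply: (@lle_trans _ _ (fop L f (upd x i (linf (fun w : L =>
  lle (fop L f (upd x i w)) (x i)))))); last first.
  by rewrite fop_del //; apply/lsupP => _ [w Dw ->].
by rewrite -(linf_min yD) fop_del //; apply: lsup_ub; exists y; first left.
Qed.

Lemma flat_one (g : Gconn S) i x (y : L) : epsG g i = one ->
  lle (flat i x) y <-> lle (x i) (gop L g (upd x i y)).
Proof.
move=> e; rewrite /flat e; split=> [yD|]; last by move=> h; apply: (@linf_lb L).
apply: (@lle_trans _ _ (gop L g (upd x i (linf (fun w : L =>
  lle (x i) (gop L g (upd x i w))))))).
  by rewrite gop_one //; apply/linfP => _ [w Dw ->].
by rewrite -(linf_min yD) gop_one //; apply: linf_lb; exists y; first left.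
Qed.

Lemma flat_del (g : Gconn S) i x (y : L) : epsG g i = del ->
  lle y (flat i x) <-> lle (x i) (gop L g (upd x i y)).
Proof.
move=> e; rewrite /flat e; split=> [yD|]; last by move=> h; apply: (@lsup_ub L).
apply: (@lle_trans _ _ (gop L g (upd x i (lsup (fun w : L =>
  lle (x i) (gop L g (upd x i w))))))).
  by rewrite gop_del //; apply/linfP => _ [w Dw ->].
by rewrite -(lsup_max yD) gop_del //; apply: linf_lb; exists y; first left.
Qed.

End Adjunctions.

(* Main.v *)
Require Import Defs.
From Stdlib Require List.
From Stdlib Require Import Classical FunctionalExtensionality PropExtensionality.
From mathcomp Require Import all_boot.

Set Implicit Arguments.
Unset Strict Implicit.
Unset Printing Implicit Defensive.

(* The substance of the theorem is cut elimination.  A residual-free sequent has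
   the same value as a sequent of formulas, so let [R] be a relation between
   formulas closed under the cut-free rules, applied at any place that is
   displayable below +f and -g.  The formulas, together with the residual
   structures whose residuals lie on a single spine, form a polarity with [R] as
   its incidence relation; its Galois-closed sets are a complete algebra, and
   since each formula belongs to its own value on both sides, [R] contains every
   valid sequent.  Now take for [R] the valid sequents that have the inversion
   property demanded by the refutation rules (for instance: if f(X) |- p, then
   some X_i is bottom, or top when the i-th coordinate is reversed).  Validity is
   preserved by the cut-free rules because values of displayable contexts are
   residuated, and the inversion property is preserved because these rules act
   on one argument at a time. *)

(** * Coordinate updates and membership in lists *)

Lemma upd_same (n : nat) (T : Type) (a : 'I_n -> T) i x : upd a i x i = x.
Proof. by rewrite /upd eqxx. Qed.

Lemma upd_id (n : nat) (T : Type) (a : 'I_n -> T) i : upd a i (a i) = a.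
Proof.
by apply: functional_extensionality => j; rewrite /upd; case: eqP => // ->.
Qed.

Lemma upd_upd (n : nat) (T : Type) (a : 'I_n -> T) i x y :
  upd (upd a i x) i y = upd a i y.
Proof.
by apply: functional_extensionality => j; rewrite /upd; case: eqP.
Qed.

Lemma upd_comp (n : nat) (T U : Type) (h : T -> U) (a : 'I_n -> T) i x :
  (fun j => h (upd a i x j)) = upd (fun j => h (a j)) i (h x).
Proof.
by apply: functional_extensionality => j; rewrite /upd; case: eqP.
Qed.

Lemma In_cat (T : Type) (s t : seq T) x :
  List.In x (s ++ t) <-> List.In x s \/ List.In x t.
Proof. by elim: s => [|y s IH] /=; [split=> [|[]]; auto | rewrite IH; tauto]. Qed.

Lemma In_map (T U : Type) (h : T -> U) s y :
  List.In y (map h s) <-> exists2 x, List.In x s & y = h x.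
Proof.
elim: s => [|x s IH] /=; first by split=> // -[].
rewrite IH; split=> [[<-|[z zs ->]]|[z [->|zs] ->]].
- by exists x; first left.
- by exists z; first right.
- by left.
- by right; exists z.
Qed.

Lemma In_mem (T : eqType) (s : seq T) x : x \in s -> List.In x s.
Proof. by elim: s => //= y s IH; rewrite inE => /orP[/eqP ->|/IH]; auto. Qed.

Lemma In_map_enum (n : nat) (T : Type) (s : 'I_n -> T) i :
  List.In (s i) [seq s j | j <- enum 'I_n].
Proof. by apply/In_map; exists i => //; apply: In_mem; rewrite mem_enum. Qed.

Lemma In_flatten_enum (n : nat) (T : Type) (s : 'I_n -> seq T) x :
  List.In x (flatten [seq s j | j <- enum 'I_n]) <-> exists i, List.In x (s i).
Proof.
split=> [|[i xs]].
  by elim: (enum 'I_n) => //= j r IH /In_cat[xs|/IH //]; exists j.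
have: i \in enum 'I_n by rewrite mem_enum.
elim: (enum 'I_n) => //= j r IH; rewrite inE => /orP[/eqP <-|/IH xr].
  by apply/In_cat; left.
by apply/In_cat; right.
Qed.

Definition opp (p : position) : position := act p del.

Lemma oppK p : opp (opp p) = p. Proof. by case: p. Qed.

(** * Displayable contexts and the closure conditions of cut-free derivability *)

Section Connectives.
Context (S : le_signature).

(* F and G are merged, so that each statement about f in precedent position
   and its dual about g in succedent position are proved at once. *)
Definition lconn : Type := (Fconn S + Gconn S)%type.

Definition ar (h : lconn) : nat :=
  match h with inl f => arF f | inr g => arG g end.

Definition eps (h : lconn) : 'I_(ar h) -> otype :=
  match h with inl f => epsF f | inr g => epsG g end.

Definition pos (h : lconn) : position := if h is inl _ then Pre else Suc.

Definition arg_pos (h : lconn) (i : 'I_(ar h)) : position :=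
  act (pos h) (eps i).

Definition app (h : lconn) : ('I_(ar h) -> formula S) -> formula S :=
  match h with inl f => FApp f | inr g => GApp g end.

Lemma app_inj (h : lconn) (X Y : 'I_(ar h) -> formula S) :
  app X = app Y -> X = Y.
Proof.
case: h X Y => h X Y [e];
  exact: (Classical_Prop.EqdepTheory.inj_pair2 _ _ _ _ _ e).
Qed.

Definition vac (p : position) : formula S := if p is Pre then Bot else Top.

(* The binary connective whose rules in position [p] have a single premise. *)
Definition junct (p : position) (A B : formula S) : formula S :=
  if p is Pre then And A B else Or A B.

(* [path p q c]: the hole of [c] is in position [p] when [c] itself is in
   position [q], and only labels +f and -g lie above it. *)
Inductive path : position -> position -> (formula S -> formula S) -> Prop :=
  | path_nil p : path p p id
  | path_cons p h a (i : 'I_(ar h)) c : path p (arg_pos i) c ->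
      path p (pos h) (fun A => app (upd a i (c A))).

(** [path_cons] wraps a layer around the outside of a context, whereas plugging into a [Res] puts a
    connective immediately around the hole. *)
Lemma path_snoc p q c h (a : 'I_(ar h) -> formula S) i :
  path p q c -> pos h = p ->
  path (arg_pos i) q (fun A => c (app (upd a i A))).
Proof.
move=> pc; elim: pc h a i => {p q c} [p|p k b j c pc IH] h a i e.
  by rewrite -e; apply: (@path_cons _ h a i id); apply: path_nil.
by apply: (@path_cons _ k b j (fun A => c (app (upd a i A)))); apply: IH.
Qed.

(* [cover p A Fs]: a cut-free rule introduces [A] in position [p] from
   premises with the formulas of [Fs] in its place. *)
Inductive cover (p : position) : formula S -> (formula S -> Prop) -> Prop :=
  | cover_vac : cover p (vac p) (fun _ => False)
  | cover_left A B : cover p (junct p A B) (eq A)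
  | cover_right A B : cover p (junct p A B) (eq B)
  | cover_both A B :
      cover p (junct (opp p) A B) (fun C => C = A \/ C = B).

(* [R p A B] stands for the sequent with [A] on side [p] and [B] on the other
   side. *)
Record gentzen (R : position -> formula S -> formula S -> Prop) : Prop := {
  gentzen_sym p A B : R p A B -> R (opp p) B A;
  gentzen_atom p n : R p (Atom n) (Atom n);
  gentzen_cover p q c A Fs B : path p q c -> cover p A Fs ->
    (forall C, Fs C -> R q (c C) B) -> R q (c A) B;
  gentzen_app h (X Y : 'I_(ar h) -> formula S) :
    (forall i, R (arg_pos i) (X i) (Y i)) -> R (pos h) (app X) (app Y)
}.

End Connectives.

Arguments vac {S} p.

(** * The complete algebra of Galois-closed sets *)

Section PolarityAlgebra.
Context (S : le_signature).
Context (R : position -> formula S -> formula S -> Prop).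
Context (gR : gentzen R).

(* [Res w h a i] is the residual structure of [h] in coordinate [i] with [w]
   in that coordinate: such residuals occur only along a spine. *)
Inductive elt : Type :=
  | Base of position & formula S
  | Res (w : elt) (h : lconn S) of ('I_(ar h) -> formula S) & 'I_(ar h).

Definition side (w : elt) : position :=
  match w with Base p _ => p | Res _ h _ i => opp (arg_pos i) end.

(** A display rule moves the side facing an application of [h] into coordinate [i]; hence [w] must
    stand on the side opposite to [h]. *)
Fixpoint good (w : elt) : Prop :=
  match w with Base _ _ => True | Res w h _ _ => good w /\ side w = opp (pos h) end.

(* The display form of the sequent having [w] and [A] as its two sides. *)
Fixpoint plug (w : elt) (A : formula S) : Prop :=
  match w with
  | Base p B => R (opp p) A B
  | Res w h a i => plug w (app (upd a i A))
  end.

(** Unfolding the spine of [w] puts the plugged formula under a displayable context on one side of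
    [R], the form in which [gentzen_cover] applies. *)
Lemma plug_path w : good w ->
  exists q c B, path (opp (side w)) q c /\ forall A, plug w A = R q (c A) B.
Proof.
elim: w => [p B|w IH h a i] /=.
  by move=> _; exists (opp p), id, B; split=> //; apply: path_nil.
move=> [/IH [q [c [B [pc Ec]]]] e].
exists q, (fun A => c (app (upd a i A))), B; split=> //.
rewrite oppK; apply: (path_snoc _ _ pc); by rewrite e oppK.
Qed.

Lemma plug_cover w A Fs : good w -> cover (opp (side w)) A Fs ->
  (forall C, Fs C -> plug w C) -> plug w A.
Proof.
move=> /plug_path [q [c [B [pc Ec]]]] cov FP; rewrite Ec.
by apply: (gentzen_cover gR pc cov) => C /FP; rewrite Ec.
Qed.

(* Two residuals facing each other are always orthogonal, because the sequent
   they form has no residual-free display form. *)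
Definition orth2 (w w' : elt) : Prop :=
  (forall p A, w = Base p A -> plug w' A) /\
  (forall p A, w' = Base p A -> plug w A).

Lemma orth2_sym w w' : orth2 w w' -> orth2 w' w.
Proof. by case. Qed.

Lemma orth2_base w p A : side w = opp p -> orth2 (Base p A) w <-> plug w A.
Proof.
move=> e; split=> [[h _]|h]; first exact: (h p).
split=> [_ _ [_ <-] //|q B ew]; move: e h; rewrite ew /= => -> /(gentzen_sym gR).
by rewrite !oppK.
Qed.

Definition orth (p : position) (X : elt -> Prop) (w : elt) : Prop :=
  [/\ good w, side w = p & forall w', X w' -> orth2 w w'].

(** The components at [Pre] and [Suc] are the extent and the intent of a formal concept; keeping
    both treats the two positions alike. *)
Definition polar (x : position -> elt -> Prop) : Prop :=
  forall p w, x p w <-> orth p (x (opp p)) w.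

Definition pcar : Type := {x : position -> elt -> Prop | polar x}.

Definition pset (x : pcar) : position -> elt -> Prop := sval x.

Lemma psetP (x : pcar) p w : pset x p w <-> orth p (pset x (opp p)) w.
Proof. exact: (svalP x). Qed.

Lemma pset_side (x : pcar) p w : pset x p w -> side w = p.
Proof. by case/psetP. Qed.

Lemma pset_orth (x : pcar) p w w' :
  pset x p w -> pset x (opp p) w' -> orth2 w w'.
Proof. by case/psetP => _ _; apply. Qed.

Lemma pset_base (x : pcar) p A :
  pset x p (Base p A) <-> forall w, pset x (opp p) w -> plug w A.
Proof.
split=> [xA w xw|h].
  exact: (proj1 (orth2_base A (pset_side xw)) (pset_orth xA xw)).
by apply/psetP; split=> // w xw; apply/(orth2_base A (pset_side xw)); apply: h.
Qed.

Lemma orth_orth p (X : elt -> Prop) w :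
  good w -> side w = p -> X w -> orth p (orth (opp p) X) w.
Proof. by move=> gw sw Xw; split=> // w' [_ _ h]; apply/orth2_sym/h. Qed.

(** The triple-orthogonal law of a Galois connection, relativized to good elements of a fixed side,
    since [orth] retains only those. *)
Lemma orth3 p (X : elt -> Prop) (w : elt) :
  (forall w', X w' -> good w' /\ side w' = opp p) ->
  orth p X w <-> orth p (orth (opp p) (orth p X)) w.
Proof.
move=> gX; split=> [[gw sw h]|[gw sw h]]; split=> // w' Xw'.
  by case: Xw' => _ _ h'; apply/orth2_sym/h'.
have [gw' sw'] := gX _ Xw'; apply: h; split=> // w2 [_ _ h2].
by apply/orth2_sym/h2.
Qed.

Definition close_set (p : position) (X : elt -> Prop) (q : position) :
    elt -> Prop :=
  match p, q with
  | Pre, Suc | Suc, Pre => orth q X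
  | _, _ => orth q (orth (opp q) X)
  end.

Lemma close_polar p X : (forall w, X w -> good w /\ side w = p) ->
  polar (close_set p X).
Proof. by case: p => gX [] w /=; try exact: orth3. Qed.

Definition close p X (gX : forall w, X w -> good w /\ side w = p) : pcar :=
  exist _ _ (close_polar gX).

Lemma pset_close_opp p X (gX : forall w, X w -> good w /\ side w = p) :
  pset (close gX) (opp p) = orth (opp p) X.
Proof. by case: p gX. Qed.

Lemma pset_close p X (gX : forall w, X w -> good w /\ side w = p) w :
  X w -> pset (close gX) p w.
Proof.
move=> Xw; apply/psetP; rewrite pset_close_opp; have [gw sw] := gX _ Xw.
exact: orth_orth.
Qed.

Lemma pcar_eq p (x y : pcar) : (forall w, pset x p w <-> pset y p w) -> x = y.
Proof.
move=> h; have h' w : pset x (opp p) w <-> pset y (opp p) w.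
  rewrite !(psetP _ (opp p)) oppK.
  by split=> -[gw sw k]; split=> // w' /h; apply: k.
have E : sval x = sval y.
  apply: functional_extensionality => q; apply: functional_extensionality => w.
  apply: propositional_extensionality.
  by case: p q h h' => [] [] h h'; [apply: h | apply: h' | apply: h' | apply: h].
case: x y E {h h'} => x px [y py] /= E.
by move: px py; rewrite E => px py; congr exist; apply: proof_irrelevance.
Qed.

Definition psub (p : position) (x y : pcar) : Prop :=
  forall w, pset x p w -> pset y p w.

Lemma psub_opp p x y : psub p x y -> psub (opp p) y x.
Proof.
move=> h w /psetP [gw sw k]; apply/psetP; split=> // w'; rewrite oppK => xw'.
by apply: k; rewrite oppK; apply: h.
Qed.

Lemma union_good p (D : pcar -> Prop) w : (exists2 x, D x & pset x p w) ->
  good w /\ side w = p.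
Proof. by case=> x _ /psetP []. Qed.

(* The join if [p] is [Pre], the meet if [p] is [Suc]. *)
Definition psup (p : position) (D : pcar -> Prop) : pcar :=
  close (@union_good p D).

Lemma pset_psup p D w : pset (psup p D) (opp p) w <->
  [/\ good w, side w = opp p & forall x, D x -> pset x (opp p) w].
Proof.
rewrite pset_close_opp; split=> -[gw sw h]; split=> //.
  move=> x Dx; apply/psetP; split=> // w'; rewrite oppK => xw'.
  by apply: h; exists x.
move=> w' [x Dx xw']; apply/orth2_sym.
exact: (pset_orth xw' (h x Dx)).
Qed.

Lemma psupP p D u : psub p (psup p D) u <-> forall x, D x -> psub p x u.
Proof.
split=> [h x Dx w xw|h].
  by apply: h; apply: pset_close; exists x.
suff: psub (opp (opp p)) (psup p D) u by rewrite oppK.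
apply: psub_opp => w uw; apply/pset_psup.
have [gw sw _] := proj1 (psetP _ _ _) uw; split=> // x Dx.
by have := psub_opp (h x Dx); apply.
Qed.

(** The generators are formulas only, so that membership on the opposite side amounts to plugging
    applications of [h]. *)
Definition pgen (h : lconn S) (x : 'I_(ar h) -> pcar) (w : elt) : Prop :=
  exists2 a, w = Base (pos h) (app a) &
    forall i, pset (x i) (arg_pos i) (Base (arg_pos i) (a i)).

Lemma pgen_good h (x : 'I_(ar h) -> pcar) w :
  pgen x w -> good w /\ side w = pos h.
Proof. by case=> a ->. Qed.

Definition pop (h : lconn S) (x : 'I_(ar h) -> pcar) : pcar :=
  close (@pgen_good h x).

Lemma pset_pop h (x : 'I_(ar h) -> pcar) w : pset (pop x) (opp (pos h)) w <->
  [/\ good w, side w = opp (pos h) & forall a,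
      (forall i, pset (x i) (arg_pos i) (Base (arg_pos i) (a i))) ->
      plug w (app a)].
Proof.
rewrite pset_close_opp; split=> -[gw sw k]; split=> //.
  move=> a xa; apply/(orth2_base (app a) sw)/orth2_sym; apply: k.
  by exists a.
move=> w' [a -> xa]; apply/orth2_sym/(orth2_base (app a) sw); exact: k.
Qed.

(* The element [Res w h a i] of the other side is what closes the set of
   admissible [i]-th arguments. *)
Lemma pop_psup h (i : 'I_(ar h)) x (D : pcar -> Prop) :
  pop (upd x i (psup (arg_pos i) D)) =
  psup (pos h) (img (fun y => pop (upd x i y)) D).
Proof.
apply: (@pcar_eq (opp (pos h))) => w; rewrite pset_psup pset_pop.
split=> -[gw sw k]; split=> //.
  move=> _ [y Dy ->]; apply/pset_pop; split=> // a xa; apply: k => j.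
  move: (xa j); rewrite /upd; case: eqP => // -> ya.
  by apply: (proj1 (psupP (arg_pos i) D _) _ y Dy) => // w'.
move=> a xa; rewrite -[a](upd_id _ i).
have ri : pset (psup (arg_pos i) D) (opp (arg_pos i)) (Res w a i).
  apply/pset_psup; split=> // y Dy; apply/psetP; split=> // w'; rewrite oppK => yw'.
  split=> // q A ew' /=; move: yw'; rewrite {}ew' => yA.
  have /= eq_q := pset_side yA; rewrite {}eq_q in yA.
  have [_ _] := proj1 (pset_pop _ _) (k _ (ex_intro2 _ _ y Dy erefl)); apply=> j.
  by move: (xa j); rewrite /upd; case: eqP => // ->.
by move: (xa i); rewrite upd_same => /pset_base /(_ _ ri).
Qed.

(** Inclusion of extents reverses inclusion of intents, so [psup Suc] serves as the infimum. *)
Definition polarity_lattice : complete_lattice.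
Proof.
refine (@CompleteLattice pcar (psub Pre) _ _ _ (psup Pre) _ (psup Suc) _).
- by move=> x w.
- by move=> x y xy yx; apply: (@pcar_eq Pre) => w; split; [apply: xy|apply: yx].
- by move=> x y z xy yz w /xy /yz.
- exact: psupP.
- move=> D l; split=> [h x Dx|h].
    apply: (@psub_opp Suc); apply: (proj1 (psupP Suc D l)) => //.
    exact: (@psub_opp Pre).
  by apply: (@psub_opp Suc); apply/psupP => x Dx; apply: (@psub_opp Pre); apply: h.
Defined.

Definition polarity_algebra : le_algebra S.
Proof.
refine (@LeAlgebra S polarity_lattice (fun f => @pop (inl f))
  (fun g => @pop (inr g)) _ _ _ _).
- by move=> f i x D e; have := @pop_psup (inl f) i x D; rewrite /arg_pos /= e.
- by move=> f i x D e; have := @pop_psup (inl f) i x D; rewrite /arg_pos /= e.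
- by move=> f i x D e; have := @pop_psup (inr f) i x D; rewrite /arg_pos /= e.
- by move=> f i x D e; have := @pop_psup (inr f) i x D; rewrite /arg_pos /= e.
Defined.

Lemma atom_good n w : w = Base Pre (Atom n) -> good w /\ side w = Pre.
Proof. by move->. Qed.

Definition pval (n : nat) : polarity_algebra := close (@atom_good n).

Lemma base_atom p n : pset (pval n) p (Base p (Atom n)).
Proof.
case: p; first exact: pset_close.
rewrite -[Suc]/(opp Pre) pset_close_opp; split=> // _ ->.
by apply/orth2_base => //=; apply: (gentzen_atom gR).
Qed.

Lemma base_vac p q : pset (psup p (fun=> False)) q (Base q (vac p)).
Proof.
have [->|->] : q = p \/ q = opp p by case: p q => [] []; auto.
  apply/pset_base => w /pset_psup [gw sw _].
  have cov : cover (opp (side w)) (@vac S p) (fun=> False).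
    by rewrite sw oppK; apply: cover_vac.
  by apply: (plug_cover gw cov).
by apply/pset_psup.
Qed.

Lemma base_junct (x y : pcar) A B p q :
  (forall r, pset x r (Base r A)) -> (forall r, pset y r (Base r B)) ->
  pset (psup p (fun z => z = x \/ z = y)) q (Base q (junct (opp p) A B)).
Proof.
move=> xA yB; have [->|->] : q = p \/ q = opp p by case: p q => [] []; auto.
  apply/pset_base => w /pset_psup [gw sw h].
  apply: (plug_cover gw); first by rewrite sw oppK; apply: cover_both.
  move=> C [->|->].
    by apply: (proj1 (pset_base _ _ _) (xA _)); apply: h; left.
  by apply: (proj1 (pset_base _ _ _) (yB _)); apply: h; right.
apply/pset_psup; split=> // z [->|->]; apply/pset_base => w zw;
  have [gw sw _] := proj1 (psetP _ _ _) zw; apply: (plug_cover gw).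
- by rewrite sw oppK; apply: cover_left.
- by move=> _ <-; apply: (proj1 (pset_base _ _ _) (xA _)) zw.
- by rewrite sw oppK; apply: cover_right.
- by move=> _ <-; apply: (proj1 (pset_base _ _ _) (yB _)) zw.
Qed.

Lemma base_app h (x : 'I_(ar h) -> pcar) X q :
  (forall i r, pset (x i) r (Base r (X i))) ->
  pset (pop x) q (Base q (app X)).
Proof.
move=> xX; have [->|->] : q = pos h \/ q = opp (pos h).
  by case: (pos h) q => [] []; auto.
  by apply: pset_close; exists X.
apply/pset_pop; split=> // a xa /=; rewrite oppK.
apply: (gentzen_app gR) => i.
have := proj1 (pset_base _ _ _) (xa i) _ (xX i _); by rewrite /= oppK.
Qed.

(** The truth lemma: at each connective, one side holds by generation or by the one-premise rules,
    the other by the rule acting on all components. *)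
Lemma base_forval A p : pset (forval pval A) p (Base p A).
Proof.
elim: A p => [n|||A IA B IB|A IA B IB|f X IX|g X IX] p /=.
- exact: base_atom.
- exact: (base_vac Pre).
- exact: (base_vac Suc).
- exact: (@base_junct _ _ _ _ Suc).
- exact: (@base_junct _ _ _ _ Pre).
- exact: (@base_app (inl f)).
- exact: (@base_app (inr g)).
Qed.

(** [A] lies in the extent of its own value, hence by validity in that of [B]; it is therefore
    orthogonal to [B], which lies in the intent. *)
Theorem gentzen_complete A B : valid (SForm A, SForm B) -> R Pre A B.
Proof.
move=> /(_ polarity_algebra pval) /= h.
have := proj1 (pset_base _ _ _) (h _ (base_forval A Pre)) _ (base_forval B Suc).
by [].
Qed.

End PolarityAlgebra.

(** * Adjunction and monotonicity, uniformly in both positions *)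

Section Semantics.
Context (S : le_signature) (L : le_algebra S).

Definition ple (p : position) (x y : L) : Prop :=
  if p is Pre then lle x y else lle y x.

Lemma ple_refl p x : ple p x x.
Proof. by case: p; apply: lle_refl. Qed.

Lemma ple_trans p x y z : ple p x y -> ple p y z -> ple p x z.
Proof.
by case: p => /= h1 h2; [apply: lle_trans h1 h2 | apply: lle_trans h2 h1].
Qed.

Lemma ple_opp p x y : ple p x y -> ple (opp p) y x.
Proof. by case: p. Qed.

Definition aop (h : lconn S) : ('I_(ar h) -> L) -> L :=
  match h with inl f => fop L f | inr g => gop L g end.

Lemma forval_app v h (X : 'I_(ar h) -> formula S) :
  forval v (app X) = aop (fun i => forval (L := L) v (X i)).
Proof. by case: h X. Qed.

Lemma aop_adjoint h (i : 'I_(ar h)) (x : 'I_(ar h) -> L) y :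
  exists r, forall z, ple (pos h) (aop (upd x i z)) y <-> ple (arg_pos i) z r.
Proof.
case: h i x => [f|g] i x; rewrite /arg_pos /=.
  case e: (epsF f i); exists (sharp i (upd x i y)) => z /=.
    by rewrite sharp_one // upd_upd upd_same.
  by rewrite sharp_del // upd_upd upd_same.
case e: (epsG g i); exists (flat i (upd x i y)) => z /=.
  by rewrite flat_one // upd_upd upd_same.
by rewrite flat_del // upd_upd upd_same.
Qed.

Lemma aop_mono1 h (i : 'I_(ar h)) (x : 'I_(ar h) -> L) z z' :
  ple (arg_pos i) z z' -> ple (pos h) (aop (upd x i z)) (aop (upd x i z')).
Proof.
move=> zz'; have [r rP] := aop_adjoint i x (aop (upd x i z')).
by apply/rP; apply: ple_trans zz' _; apply/rP; apply: ple_refl.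
Qed.

Lemma aop_mono h (x y : 'I_(ar h) -> L) :
  (forall i, ple (arg_pos i) (x i) (y i)) -> ple (pos h) (aop x) (aop y).
Proof.
(* [z m] takes its first [m] coordinates from [y] and the others from [x], so passing to [m.+1]
   changes a single coordinate. *)
move=> xy; pose z m := fun j : 'I_(ar h) => if j < m then y j else x j.
have zP m : m <= ar h -> ple (pos h) (aop x) (aop (z m)).
  elim: m => [_|m IH lt_m]; first exact: ple_refl.
  apply: ple_trans (IH (ltnW lt_m)) _; pose i := Ordinal lt_m.
  have -> : z m.+1 = upd (z m) i (y i).
    apply: functional_extensionality => j; rewrite /upd /z ltnS leq_eqVlt.
    by rewrite -[j == i]/(val j == m); case: eqP => // e; congr y; apply: val_inj.
  rewrite -{1}[z m](upd_id _ i); apply: aop_mono1.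
  by rewrite /z /= ltnn.
have := zP _ (leqnn _); congr ple; congr aop.
by apply: functional_extensionality => j; rewrite /z ltn_ord.
Qed.

(** The adjoints of the connectives along the path compose; the bound [r] is the same for all
    plugged formulas. *)
Lemma path_adjoint v p q c y : path p q c ->
  exists r, forall A, ple q (forval v (c A)) y <-> ple p (forval v A) r.
Proof.
move=> pc; elim: pc y => {p q c} [p|p h a i c pc IH] y; first by exists y.
have [r rP] := aop_adjoint i (fun j => forval v (a j)) y.
have [r' rP'] := IH r; exists r' => A.
by rewrite forval_app (upd_comp (forval v)) rP.
Qed.

Lemma ple_cover v p A Fs r : cover p A Fs ->
  (forall C, Fs C -> ple p (forval v C) r) -> ple p (forval v A) r.
Proof.
case=> {A Fs} [|A B|A B|A B] FP; case: p FP => /= FP.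
- by apply/lsupP.
- by apply/linfP.
- by apply: lle_trans (FP _ erefl); apply: linf_lb; left.
- by apply: lle_trans (FP _ erefl) _; apply: lsup_ub; left.
- by apply: lle_trans (FP _ erefl); apply: linf_lb; right.
- by apply: lle_trans (FP _ erefl) _; apply: lsup_ub; right.
- by apply/lsupP => _ [] ->; apply: FP; [left|right].
- by apply/linfP => _ [] ->; apply: FP; [left|right].
Qed.

End Semantics.

(** * Inversion properties of valid sequents *)

Section Inversion.
Context (S : le_signature).

Definition fvalid (p : position) (A B : formula S) : Prop :=
  forall (L : le_algebra S) (v : nat -> L), ple p (forval v A) (forval v B).

Lemma fvalid_opp p A B : fvalid p A B -> fvalid (opp p) B A.
Proof. by move=> h L v; apply/ple_opp/h. Qed.

Lemma fvalid_cover p q c A Fs B : path p q c -> cover p A Fs ->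
  (forall C, Fs C -> fvalid q (c C) B) -> fvalid q (c A) B.
Proof.
move=> pc cov FP L v; have [r rP] := path_adjoint v (forval v B) pc.
by apply/rP; apply: ple_cover cov _ => C /FP h; apply/rP.
Qed.

Lemma fvalid_vac p A B : fvalid p A (vac p) -> fvalid p A B.
Proof.
move=> h L v; apply: ple_trans (h L v) _.
by apply: (ple_cover (cover_vac S p)).
Qed.

(** Such an argument collapses the application to [vac (pos h)], since the operations respect empty
    joins and meets in each coordinate. *)
Definition dead (h : lconn S) (X : 'I_(ar h) -> formula S) : Prop :=
  exists i, fvalid (arg_pos i) (X i) (vac (arg_pos i)).

(** Either a coordinate other than [i] is already dead, or every premise is dead at [i] itself and
    validity recombines there. *)
Lemma dead_cover p h (a : 'I_(ar h) -> formula S) i c A Fs :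
  path p (arg_pos i) c -> cover p A Fs ->
  (forall C, Fs C -> dead (upd a i (c C))) -> dead (upd a i (c A)).
Proof.
move=> pc cov FP.
have [[j ji dj]|nd] := classic (exists2 j, j != i &
    fvalid (arg_pos j) (a j) (vac (arg_pos j))).
  by exists j; rewrite /upd (negbTE ji).
exists i; rewrite upd_same; apply: fvalid_cover pc cov _ => C /FP [j].
rewrite /upd; case: eqP => [-> //|/eqP ji dj].
by case: nd; exists j.
Qed.

(** Branching transferred to formulas, with the root held to the same labels as the nodes below
    it. *)
Fixpoint fcritical (p : position) (A : formula S) : Prop :=
  match A with
  | And _ _ => p = Suc
  | Or _ _ => p = Pre
  | FApp f a => p = Pre /\ exists i, fcritical (act p (epsF f i)) (a i)
  | GApp g a => p = Suc /\ exists i, fcritical (act p (epsG g i)) (a i)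
  | _ => False
  end.

Lemma fcritical_path p q c (A B : formula S) : path p q c ->
  fcritical q (c (junct (opp p) A B)).
Proof.
elim=> {p q c} [[]//|p h a i c pc IH].
by case: h a i pc IH => [f|g] a i pc IH; split=> //; exists i; rewrite upd_same.
Qed.

Lemma freducts_path p q c (A B C : formula S) : path p q c -> C = A \/ C = B ->
  List.In (c C) (freducts q (c (junct p A B))).
Proof.
move=> pc CAB; elim: pc CAB => {p q c} [p|p h a i c pc IH] CAB.
  by case: p CAB => [] [->|->] /=; auto.
case: h a i pc IH => [f|g] a i pc IH; apply/In_flatten_enum; exists i;
  rewrite upd_same; apply/In_map; exists (c C) => //; try exact: IH;
  by rewrite upd_upd.
Qed.

(** The alternatives mirror the premises of [r_andL] and [r_orR], the guard their non-branching
    condition. *)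
Definition junct_inv (p : position) (A1 A2 B : formula S) : Prop :=
  ~ fcritical (opp p) B ->
  [\/ fvalid p A1 B, fvalid p A2 B | exists2 B',
      List.In B' (freducts (opp p) B) & fvalid p (junct p A1 A2) B'].

(* What a valid sequent with [app X] on side [pos h], no argument of which is
   dead, requires of its other side [B]. *)
Definition app_match (h : lconn S) (X : 'I_(ar h) -> formula S)
    (B : formula S) : Prop :=
  match B with
  | Atom _ => False
  | Bot => pos h = Suc
  | Top => pos h = Pre
  | And _ _ | Or _ _ => True
  | FApp f Y =>
      if pos h is Suc then dead (h := inl f) Y else
      exists2 Y', B = app Y' & forall i, fvalid (arg_pos i) (X i) (Y' i)
  | GApp g Y =>
      if pos h is Pre then dead (h := inr g) Y else
      exists2 Y', B = app Y' & forall i, fvalid (arg_pos i) (X i) (Y' i)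
  end.

Definition app_inv (h : lconn S) (X : 'I_(ar h) -> formula S)
  (B : formula S) : Prop := dead X \/ app_match X B.

Definition invertible (p : position) (A B : formula S) : Prop :=
  match A with
  | And A1 A2 => p = Pre -> junct_inv p A1 A2 B
  | Or A1 A2 => p = Suc -> junct_inv p A1 A2 B
  | FApp f X => p = Pre -> app_inv (h := inl f) X B
  | GApp g X => p = Suc -> app_inv (h := inr g) X B
  | _ => True
  end.

(** Unless the conclusion is dead, some premise [C] is not, and its match determines the shape of
    [B]. Coordinates other than [i] are inherited from [C]; the [i]-th is reassembled from all
    premises. *)
Lemma app_inv_cover p h (a : 'I_(ar h) -> formula S) i c A Fs B :
  path p (arg_pos i) c -> cover p A Fs ->
  (forall C, Fs C -> app_inv (upd a i (c C)) B) ->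
  app_inv (upd a i (c A)) B.
Proof.
move=> pc cov FP.
have [dA|ndA] := classic (dead (upd a i (c A))); first by left.
have [C FC ndC] : exists2 C, Fs C & ~ dead (upd a i (c C)).
  apply: NNPP => nC; apply: ndA; apply: dead_cover pc cov _ => C FC.
  by apply: NNPP => ndC; apply: nC; exists C.
have same (Y : 'I_(ar h) -> formula S) : B = app Y ->
    (forall D, Fs D -> dead (upd a i (c D)) \/
      exists2 Y', B = app Y' &
        forall j, fvalid (arg_pos j) (upd a i (c D) j) (Y' j)) ->
    exists2 Y', B = app Y' & forall j, fvalid (arg_pos j) (upd a i (c A) j) (Y' j).
  move=> eB FB; exists Y => // j; case: (FB C FC) => // -[Y1 eB1 h1].
  rewrite eB in eB1; rewrite -(app_inj eB1) in h1.
  move: (h1 j); rewrite /upd; case: eqP => [->|//] _.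
  (* A dead premise [D] can be dead only at [i], because it agrees with [C] elsewhere; its [i]-th
     argument is then comparable with anything. *)
  apply: fvalid_cover pc cov _ => D FD; case: (FB D FD) => [[k]|[Y2 eB2 h2]].
    rewrite /upd; case: eqP => [-> /fvalid_vac //|/eqP ki dk].
    by case: ndC; exists k; rewrite /upd (negbTE ki).
  rewrite eB in eB2; rewrite -(app_inj eB2) in h2.
  by have := h2 i; rewrite upd_same.
right; have [//|] := FP _ FC; rewrite /app_inv in FP.
move: same FP; case: B => //= [f Y|g Y]; case: (pos h) => // same FP [Y1 eB h1];
  exact: (same Y1).
Qed.

(** Validity is carried along because inverting a lattice formula uses the validity of the
    premises. *)
Definition inv_valid (p : position) (A B : formula S) : Prop :=
  [/\ fvalid p A B, invertible p A B & invertible (opp p) B A].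

Lemma invertible_left p q c A Fs B : path p q c -> cover p A Fs ->
  (forall C, Fs C -> fvalid q (c C) B) ->
  (forall C, Fs C -> invertible q (c C) B) -> invertible q (c A) B.
Proof.
case=> {p q c} [p|p h a i c pc] cov FV FI.
  move: FV FI; case: cov => {A Fs} [|A1 A2|A1 A2|A1 A2] FV FI;
    case: p FV FI => //= FV FI _ _.
  - by apply: Or31; apply: FV.
  - by apply: Or31; apply: FV.
  - by apply: Or32; apply: FV.
  - by apply: Or32; apply: FV.
have key : (forall C, Fs C -> app_inv (upd a i (c C)) B) ->
    app_inv (upd a i (c A)) B.
  exact: app_inv_cover pc cov.
by case: h a i pc FV FI key => [f|g] a i pc FV FI key _; apply: key => C /FI; apply.
Qed.

(** A rule without premises makes [c A] comparable with [B1], a one-premise rule yields a reduct,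
    and a two-premise rule contradicts non-branching. *)
Lemma junct_inv_right p q c A Fs B1 B2 : path p q c -> cover p A Fs ->
  (forall C, Fs C -> fvalid (opp q) (junct (opp q) B1 B2) (c C)) ->
  junct_inv (opp q) B1 B2 (c A).
Proof.
move=> pc cov FV; rewrite /junct_inv oppK => nc; case: cov FV nc => {A Fs}.
- move=> _ _; apply: Or31; apply: fvalid_opp.
  by apply: (fvalid_cover pc (cover_vac S p)).
- move=> A1 A2 FV _; apply: Or33; exists (c A1); last exact: FV.
  by apply: freducts_path => //; left.
- move=> A1 A2 FV _; apply: Or33; exists (c A2); last exact: FV.
  by apply: freducts_path => //; right.
- by move=> A1 A2 _ []; apply: fcritical_path.
Qed.

(** With an empty path, [A] is a lattice formula that [app_match] accepts outright. Otherwise the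
    head of [c A] is of the kind opposite to [h], where a match means deadness, and [dead_cover]
    applies. *)
Lemma app_inv_right p q c A Fs h (X : 'I_(ar h) -> formula S) :
  path p q c -> cover p A Fs -> pos h = opp q ->
  (forall C, Fs C -> app_inv X (c C)) -> app_inv X (c A).
Proof.
move=> pc cov; case: pc cov => {p q c} [p|p k a i c pc] cov e FI.
  by right; case: cov {FI} => *; move: e; case: p.
have [dX|ndX] := classic (dead X); [by left|right].
have key : dead (upd a i (c A)).
  apply: dead_cover pc cov _ => C /FI [//|].
  by case: k a i e {FI} => [f|g] a i /= ->.
by case: k a i e {pc FI} key => [f|g] a i /= ->.
Qed.

Lemma invertible_right p q c A Fs B : path p q c -> cover p A Fs ->
  (forall C, Fs C -> fvalid q (c C) B) ->
  (forall C, Fs C -> invertible (opp q) B (c C)) -> invertible (opp q) B (c A).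
Proof.
move=> pc cov FV FI.
have FV' C : Fs C -> fvalid (opp q) B (c C) by move=> /FV /fvalid_opp.
case: B FI {FV} FV' => //= [B1 B2|B1 B2|f X|g X] FI FV e.
- by apply: junct_inv_right pc cov _ => C /FV; rewrite e.
- by apply: junct_inv_right pc cov _ => C /FV; rewrite e.
- by apply: app_inv_right pc cov _ _ => // C /FI; apply.
- by apply: app_inv_right pc cov _ _ => // C /FI; apply.
Qed.

Lemma inv_valid_gentzen : gentzen inv_valid.
Proof.
split.
- by move=> p A B [h1 h2 h3]; split=> //; [apply: fvalid_opp | rewrite oppK].
- by move=> p n; split=> // L v; apply: ple_refl.
- move=> p q c A Fs B pc cov FP; split.
  + by apply: fvalid_cover pc cov _ => C /FP [].
  + by apply: invertible_left pc cov _ _ => C /FP [].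
  + by apply: invertible_right pc cov _ _ => C /FP [].
- move=> h X Y XY.
  have V : forall i, fvalid (arg_pos i) (X i) (Y i) by move=> i; case: (XY i).
  split.
  + by move=> L v; rewrite !forval_app; apply: aop_mono => i; apply: V.
  + by case: h X Y V {XY} => h X Y V _; right; exists Y.
  + by case: h X Y {V XY}.
Qed.

Lemma valid_invertible A B : valid (SForm A, SForm B) ->
  invertible Pre A B /\ invertible Suc B A.
Proof. by move/(gentzen_complete inv_valid_gentzen) => []. Qed.

End Inversion.

(** * Translation of residual-free structures into formulas *)

Section Structures.
Context (S : le_signature).

(* Residual connectives have no formula counterpart and are sent to [Bot]. *)
Fixpoint toform (s : structure S) : formula S :=
  match s with
  | SForm A => A
  | STop => Top
  | SBot => Bot
  | SApp c a =>
      match c return ('I_(conn_ar c) -> formula S) -> formula S with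
      | CF f => FApp f
      | CG g => GApp g
      | _ => fun _ => Bot
      end (fun i => toform (a i))
  end.

Lemma strval_toform (L : le_algebra S) (v : nat -> L) s :
  residual_free s -> strval v s = forval v (toform s).
Proof.
elim: s => //= c a IH [rc ra].
by case: c a IH rc ra => // h a IH _ ra /=; congr (_ _);
  apply: functional_extensionality => i; apply: IH.
Qed.

Lemma valid_toform X Y : residual_free X -> residual_free Y ->
  valid (X, Y) <-> fvalid Pre (toform X) (toform Y).
Proof.
by move=> rX rY; split=> h L v; have := h L v; rewrite /= !strval_toform.
Qed.

Lemma valid_orient_pre e X Y : residual_free X -> residual_free Y ->
  fvalid (act Pre e) (toform X) (toform Y) -> valid (orient e X Y).
Proof. by move=> rX rY; case: e => h; apply/valid_toform. Qed.

Lemma valid_orient_suc e X Y : residual_free X -> residual_free Y ->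
  fvalid (act Suc e) (toform X) (toform Y) -> valid (orient e Y X).
Proof. by move=> rX rY; case: e => h; apply/valid_toform. Qed.

Lemma dead_nonbot f (X : 'I_(arF f) -> structure S) :
  (forall i, residual_free (X i)) -> dead (h := inl f) (fun i => toform (X i)) ->
  exists2 r, List.In r (nonbot_premises X) & valid r.
Proof.
move=> rX [i di]; eexists; first exact: (In_map_enum _ i).
apply: valid_orient_pre => //; first by case: (epsF f i).
by move: di; rewrite /arg_pos /=; case: (epsF f i).
Qed.

Lemma dead_nontop g (X : 'I_(arG g) -> structure S) :
  (forall i, residual_free (X i)) -> dead (h := inr g) (fun i => toform (X i)) ->
  exists2 r, List.In r (nontop_premises X) & valid r.
Proof.
move=> rX [i di]; eexists; first exact: (In_map_enum _ i).
apply: valid_orient_suc => //; first by case: (epsG g i).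
by move: di; rewrite /arg_pos /=; case: (epsG g i).
Qed.

Lemma fcritical_reaches p (A : formula S) :
  fcritical p A -> reaches_critical (p, SForm A).
Proof.
elim: A p => //= [A _ B _|A _ B _|f a IH|g a IH] p.
- by move->; apply: reaches_here.
- by move->; apply: reaches_here.
- by move=> [-> [i /IH h]]; apply: reaches_below h => //; apply: child_f.
- by move=> [-> [i /IH h]]; apply: reaches_below h => //; apply: child_g.
Qed.

Lemma toform_reaches p (s : structure S) : wf p s -> residual_free s ->
  fcritical p (toform s) -> reaches_critical (p, s).
Proof.
elim: s p => //= [A|c a IH] p; first by move=> _ _; apply: fcritical_reaches.
move=> [ec wa] [rc ra];
case: c a IH ec wa rc ra => //= h a IH <- wa _ ra [_ [i ci]];
  have r := IH i _ (wa i) (ra i) ci.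
- by apply: reaches_below r => //; apply: (@child_s S Pre (CF h) a i).
- by apply: reaches_below r => //; apply: (@child_s S Suc (CG h) a i).
Qed.

Lemma reaches_branching p (s : structure S) :
  reaches_critical (p, s) -> branching p s.
Proof.
move=> r; case E: _ / r => [n cn|n m _ nm rm]; first by left; rewrite E.
by right; exists m; rewrite ?E.
Qed.

Lemma branching_toform p (s : structure S) : wf p s -> residual_free s ->
  ~ branching p s -> ~ fcritical p (toform s).
Proof. by move=> ws rs nb /(toform_reaches ws rs) /reaches_branching. Qed.

(** Turns the third alternative of [junct_inv] back into a premise of the lattice rule. *)
Lemma toform_reducts p (s : structure S) B : wf p s -> residual_free s ->
  List.In B (freducts p (toform s)) ->
  exists t, [/\ List.In t (sreducts p s), residual_free t & toform t = B].
Proof.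
elim: s p B => //= [A|c a IH] p B.
  by move=> _ _ hB; exists (SForm B); split=> //; apply/In_map; exists B.
move=> [ec wa] [rc ra]; case: c a IH ec wa rc ra => //= h a IH <- wa _ ra;
  move=> /In_flatten_enum [i /In_map [C hC ->]];
  have [t [ti rt et]] := IH i _ _ (wa i) (ra i) hC.
- exists (SApp (CF h) (upd a i t)); split.
  + by apply/In_flatten_enum; exists i; apply/In_map; exists t.
  + by split=> // j; rewrite /upd; case: eqP.
  + by rewrite /= (upd_comp toform) et.
- exists (SApp (CG h) (upd a i t)); split.
  + by apply/In_flatten_enum; exists i; apply/In_map; exists t.
  + by split=> // j; rewrite /upd; case: eqP.
  + by rewrite /= (upd_comp toform) et.
Qed.

(** The adjunction laws, once writing [Y] into coordinate [i] and then [X i] back is seen to restore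
    [X]. *)
Lemma display_valid (q q' : sequent S) : display q q' -> valid q <-> valid q'.
Proof.
case=> {q q'} [f i X Y e|f i X Y e|g i X Y e|g i X Y e].
- suff E (L : le_algebra S) (v : nat -> L) :
    lle (strval v (SF X)) (strval v Y) <->
    lle (strval v (X i)) (strval v (SSharp i (upd X i Y)))
    by split=> h L v; apply/E.
  by rewrite /= (upd_comp (strval v)) sharp_one // upd_upd upd_same
    (upd_id (fun j => strval v (X j))).
- suff E (L : le_algebra S) (v : nat -> L) :
    lle (strval v (SF X)) (strval v Y) <->
    lle (strval v (SSharp i (upd X i Y))) (strval v (X i))
    by split=> h L v; apply/E.
  by rewrite /= (upd_comp (strval v)) sharp_del // upd_upd upd_same
    (upd_id (fun j => strval v (X j))).
- suff E (L : le_algebra S) (v : nat -> L) :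
    lle (strval v Y) (strval v (SG X)) <->
    lle (strval v (SFlat i (upd X i Y))) (strval v (X i))
    by split=> h L v; apply/E.
  by rewrite /= (upd_comp (strval v)) flat_one // upd_upd upd_same
    (upd_id (fun j => strval v (X j))).
- suff E (L : le_algebra S) (v : nat -> L) :
    lle (strval v Y) (strval v (SG X)) <->
    lle (strval v (X i)) (strval v (SFlat i (upd X i Y)))
    by split=> h L v; apply/E.
  by rewrite /= (upd_comp (strval v)) flat_del // upd_upd upd_same
    (upd_id (fun j => strval v (X j))).
Qed.

(** * A two-valued countermodel for the zero-premise rules *)

Definition prop_lattice : complete_lattice.
Proof.
refine (@CompleteLattice Prop (fun P Q => P -> Q) _ _ _
  (fun D => exists2 P, D P & P) _ (fun D => forall P, D P -> P) _).
- by [].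
- by move=> P Q PQ QP; apply: propositional_extensionality.
- by move=> P Q R PQ QR /PQ.
- by move=> D P; split=> [h Q DQ q|h [Q DQ q]]; [apply: h; exists Q | apply: (h Q)].
- by move=> D P; split=> [h Q DQ p|h p Q DQ]; [apply: h | apply: h p].
Defined.

(** With F constantly false and G constantly true, a suitable valuation makes the left side of each
    zero-premise conclusion true and the right side false. *)
Definition prop_algebra : le_algebra S.
Proof.
refine (@LeAlgebra S prop_lattice (fun _ _ => False) (fun _ _ => True) _ _ _ _).
- by move=> *; apply: propositional_extensionality; split=> // -[_ [y _ ->]].
- by move=> *; apply: propositional_extensionality; split=> // -[_ [y _ ->]].
- by move=> *; apply: propositional_extensionality; split=> // _ _ [y _ ->].
- by move=> *; apply: propositional_extensionality; split=> // _ _ [y _ ->].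
Defined.

Lemma valid_prop (q : sequent S) (v : nat -> Prop) : valid q ->
  strval (L := prop_algebra) v q.1 -> strval (L := prop_algebra) v q.2.
Proof. by move=> /(_ prop_algebra v). Qed.

Lemma valid_trans X Y X' Y' :
  (forall (L : le_algebra S) (v : nat -> L), lle (strval v X) (strval v X')) ->
  (forall (L : le_algebra S) (v : nat -> L), lle (strval v Y') (strval v Y)) ->
  valid (X', Y') -> valid (X, Y).
Proof.
move=> hX hY h L v; exact: lle_trans (hX L v) (lle_trans (h L v) (hY L v)).
Qed.

Lemma valid_invertible_toform X Y : residual_free_seq (X, Y) -> valid (X, Y) ->
  invertible Pre (toform X) (toform Y) /\ invertible Suc (toform Y) (toform X).
Proof.
case=> rX rY /(proj1 (valid_toform rX rY)) h.
by apply: valid_invertible => L v; apply: h.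
Qed.

End Structures.

(** * Soundness of the rules, one by one *)

Theorem theorem1 (S : le_signature) (ps : seq (sequent S)) (q : sequent S) :
  rule_instance ps q ->
  (forall r, List.In r ps -> ~ valid r) ->
  ~ valid q.
Proof.
move=> [ru _ [wl wr]] np vq; case: ru wl wr np vq => {ps q} /=.
- by move=> _ _ _ /(@valid_prop _ _ (fun=> False)) [] //= P [].
- move=> p _ _ _ /(@valid_prop _ _ (fun=> True)) [] //= P [].
- by move=> q _ _ _ /(@valid_prop _ _ (fun=> False)) /=; apply=> P [].
(* This valuation falsifies the atom [q] alone, so [p] stays true. *)
- by move=> p q pq _ _ _ /(@valid_prop _ _ (fun n => n <> q)) /=; apply.
- by move=> q q' /display_valid e _ _ np /e; apply: np; left.
- by move=> q q' /display_valid e _ _ np /e; apply: np; left.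
(* A dead argument contradicts a premise, and a match with [Bot] is impossible for a connective of
   F. *)
- move=> f X rf _ _ np /(valid_invertible_toform rf) [/(_ erefl) [d|//] _].
  by have [r /np] := dead_nonbot (rf.1.2) d.
- move=> f X p rf _ _ np /(valid_invertible_toform rf) [/(_ erefl) [d|//] _].
  by have [r /np] := dead_nonbot (rf.1.2) d.
- move=> g Y rf _ _ np /(valid_invertible_toform rf) [_ /(_ erefl) [d|//]].
  by have [r /np] := dead_nontop (rf.2.2) d.
- move=> p g Y rf _ _ np /(valid_invertible_toform rf) [_ /(_ erefl) [d|//]].
  by have [r /np] := dead_nontop (rf.2.2) d.
- move=> f X g Y rf _ _ np /(valid_invertible_toform rf) [/(_ erefl) [d|d] _].
    by have [r rX /np []] := dead_nonbot (rf.1.2) d; apply/In_cat; left.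
  by have [r rX /np []] := dead_nontop (rf.2.2) d; apply/In_cat; right.
- by move=> g A _ _ _ /(@valid_prop _ _ (fun=> True)) [] //= P [].
- by move=> g A p _ _ _ /(@valid_prop _ _ (fun=> False)) /=; apply.
- by move=> p f A _ _ _ /(@valid_prop _ _ (fun=> True)) /=; apply.
- by move=> f A _ _ _ /(@valid_prop _ _ (fun=> True)) /=; apply=> P [].
- by move=> g B f A _ _ _ /(@valid_prop _ _ (fun=> True)) /=; apply.
- by move=> f A Y _ _ np vq; apply: (np _ (or_introl erefl) vq).
- by move=> g A X _ _ np vq; apply: (np _ (or_introl erefl) vq).
- move=> f X A j rf _ _ np /(valid_invertible_toform rf) [/(_ erefl) [d|m] _].
    have [r rX vr] := dead_nonbot (rf.1.2) d.
    by apply: (np r _ vr); rewrite -cats1; apply/In_cat; left.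
  (* Injectivity of [app] identifies [Y'] with [A], so the [j]-th comparison contradicts the last
     premise. *)
  case: m => [Y' eA h]; apply: (np (orient (epsF f j) (X j) (SForm (A j)))).
    by rewrite -cats1; apply/In_cat; right; left.
  apply: valid_orient_pre => //; first exact: (rf.1.2 j).
  by have := h j; rewrite -(@app_inj S (inl f) _ _ eA).
- move=> g A Y j rf _ _ np /(valid_invertible_toform rf) [_ /(_ erefl) [d|]].
    have [r rX vr] := dead_nontop (rf.2.2) d.
    by apply: (np r _ vr); rewrite -cats1; apply/In_cat; left.
  move=> [Y' eA h]; apply: (np (orient (epsG g j) (SForm (A j)) (Y j))).
    by rewrite -cats1; apply/In_cat; right; left.
  apply: valid_orient_suc => //; first exact: (rf.2.2 j).
  by have := h j; rewrite -(@app_inj S (inr g) _ _ eA).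
- move=> g1 g2 A Y ne rf _ _ np /(valid_invertible_toform rf) [_ /(_ erefl) [d|]].
    by have [r /np] := dead_nontop (rf.2.2) d.
  (* A match would equate two applications, hence their heads [g1] and [g2]. *)
  by move=> [Y' [/ne]].
- move=> f1 f2 X A ne rf _ _ np /(valid_invertible_toform rf) [/(_ erefl) [d|m] _].
    by have [r /np] := dead_nonbot (rf.1.2) d.
  by case: m => [Y' [/esym /ne]].
- by move=> Y _ _ np vq; apply: (np _ (or_introl erefl) vq).
- move=> A B Y _ _ np vq; apply: (np _ (or_introl erefl)).
  by apply: valid_trans vq => L v; [apply: lsup_ub; left | apply: lle_refl].
- move=> A B Y _ _ np vq; apply: (np _ (or_introl erefl)).
  by apply: valid_trans vq => L v; [apply: lsup_ub; right | apply: lle_refl].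
- move=> X A B _ _ np vq; apply: (np _ (or_introl erefl)).
  by apply: valid_trans vq => L v; [apply: lle_refl | apply: linf_lb; left].
- move=> X A B _ _ np vq; apply: (np _ (or_introl erefl)).
  by apply: valid_trans vq => L v; [apply: lle_refl | apply: linf_lb; right].
- by move=> X _ _ np vq; apply: (np _ (or_introl erefl) vq).
(* Each alternative of [junct_inv] makes one of the premises valid. *)
- move=> A B Y nb rf _ wY np /(valid_invertible_toform rf) [/(_ erefl) h _].
  case: rf => rA rY; case: (h (branching_toform wY rY nb)) => [v|v|[B' B'in v]].
  + by apply: (np (SForm A, Y)); [left | apply/valid_toform].
  + by apply: (np (SForm B, Y)); [right; left | apply/valid_toform].
  + have [t [tin rt et]] := toform_reducts wY rY B'in.
    apply: (np (SForm (And A B), t)); last by apply/valid_toform; rewrite ?et.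
    by right; right; apply/In_map; exists t.
- move=> X A B nb rf wX _ np /(valid_invertible_toform rf) [_ /(_ erefl) h].
  case: rf => rX rA; case: (h (branching_toform wX rX nb)) => [v|v|[B' B'in v]].
  + by apply: (np (X, SForm A)); [left | apply/valid_toform].
  + by apply: (np (X, SForm B)); [right; left | apply/valid_toform].
  + have [t [tin rt et]] := toform_reducts wX rX B'in.
    apply: (np (t, SForm (Or A B))); last by apply/valid_toform; rewrite ?et.
    by right; right; apply/In_map; exists t.
Qed.
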